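(* Let $\Delta$ be a finite simplicial complex with vertex set $V$, let $f:V\to\mathbb{R}$ be injective, and let $M$ be the greedy matching on the weighted Hasse diagram of $\Delta$. If a simplex $\sigma\in\Delta$ is discrete smooth, then for every simplex $\tau\in\Delta$: $\tau\succ\sigma$ and $\tau\setminus\sigma=\{h_f(\sigma)\}$ if and only if $\sigma\rightarrow\tau$.
   Context: A finite simplicial complex $\Delta$ with (nonempty, finite) vertex set $V$ is a family of subsets of $V$ (simplices) containing every singleton $\{v\}$, $v\in V$, and closed under taking subsets (so $\emptyset\in\Delta$, of dimension $-1$). $\dim\sigma=|\sigma|-1$. We write $\sigma\prec\tau$ (or $\tau\succ\sigma$), ''$\sigma$ is a facet of $\tau$'', if $\sigma\subset\tau$ and $\dim\sigma=\dim\tau-1$. A vertex $v$ is identified with $\{v\}$ in expressions such as $\sigma\setminus v$, $\sigma\cup v$. The Hasse diagram $H$ of $\Delta$ has the simplices of $\Delta$ as nodes and an arc $\{\sigma,\tau\}$ for each pair $\sigma\prec\tau$. The weight of the arc $\{\sigma,\tau\}$ is $f(v)$, where $\tau\setminus\sigma=\{v\}$. Two arcs sharing a node always have different weights. Greedy matching $M$: start with $M=\emptyset$; while arcs remain, add all remaining arcs of minimum weight to $M$ and delete the end nodes of these arcs (with all their incident arcs). We write $\sigma\rightarrow\tau$ if $\sigma\prec\tau$ and $\{\sigma,\tau\}\in M$. For $\sigma\in\Delta$, $H(\sigma)=\{v\in V:\ v\in\sigma,\text{ or } v\notin\sigma\text{ and }\sigma\cup\{v\}\in\Delta\}$ (the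 vertices whose $f$-values are the weights of the arcs incident to $\sigma$), and $h_f(\sigma)$ is the unique vertex of $H(\sigma)$ at which $f$ is minimal. A simplex $\sigma\in\Delta$ is discrete smooth if: whenever $h_f(\sigma)\in\sigma$, then for all $\tau\succ\sigma$ one has $h_f(\tau\setminus h_f(\sigma))=h_f(\sigma)$. *)

(* Defs.v *)
From mathcomp Require Import all_boot all_order all_algebra.
From mathcomp Require Import reals.

Set Implicit Arguments.
Unset Strict Implicit.
Unset Printing Implicit Defensive.

Import Order.TTheory GRing.Theory Num.Theory.
Local Open Scope ring_scope.

(* The carrier V is itself the vertex set, hence [singleton_simplex]. *)
Record complex (V : finType) := Complex {
  simplices : {set {set V}};
  vertices_nonempty : (0 < #|V|)%N;
  singleton_simplex : forall v : V, [set v] \in simplices;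
  subset_simplex : forall s t : {set V},
    t \in simplices -> s \subset t -> s \in simplices
}.

Definition dim (V : finType) (s : {set V}) : int := #|s|%:Z - 1.

Definition facet (V : finType) (s t : {set V}) : bool :=
  (s \subset t) && (dim s == dim t - 1).

(* An arc {s, t} is encoded as the pair (s, t) with s a facet of t.  The
   diagram is taken relative to a set N of nodes, so that deleting nodes
   deletes the incident arcs. *)
Definition hasse_arcs (V : finType) (N : {set {set V}}) :
    {set {set V} * {set V}} :=
  [set a | [&& a.1 \in N, a.2 \in N & facet a.1 a.2]].

(* On an arc, a.2 :\: a.1 is a singleton [set v] and the weight is f v;
   the default 0 is only used on pairs that are not arcs. *)
Definition weight (R : realType) (V : finType) (f : V -> R)
    (a : {set V} * {set V}) : R :=
  if [pick v in a.2 :\: a.1] is Some v then f v else 0.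

Definition min_arcs (R : realType) (V : finType) (f : V -> R)
    (N : {set {set V}}) : {set {set V} * {set V}} :=
  [set a in hasse_arcs N |
    [forall b in hasse_arcs N, weight f a <= weight f b]].

Definition end_nodes (V : finType) (A : {set {set V} * {set V}}) :
    {set {set V}} :=
  [set s | [exists a in A, (s == a.1) || (s == a.2)]].

(* The state consists of the remaining nodes and the matching so far. *)
Definition greedy_step (R : realType) (V : finType) (f : V -> R)
    (st : {set {set V}} * {set {set V} * {set V}}) :
    {set {set V}} * {set {set V} * {set V}} :=
  (st.1 :\: end_nodes (min_arcs f st.1), st.2 :|: min_arcs f st.1).

(* A step is idle once no arc remains and removes nodes otherwise, so #|D|
   steps run the algorithm to completion (lemma [greedy_run_done]). *)
Definition greedy_run (R : realType) (V : finType) (D : complex V)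
    (f : V -> R) : {set {set V}} * {set {set V} * {set V}} :=
  iter #|simplices D| (greedy_step f) (simplices D, set0).

Definition greedy_matching (R : realType) (V : finType) (D : complex V)
    (f : V -> R) : {set {set V} * {set V}} := (greedy_run D f).2.

Definition matched (R : realType) (V : finType) (D : complex V)
    (f : V -> R) (s t : {set V}) : bool :=
  facet s t && ((s, t) \in greedy_matching D f).

Definition incident_vertices (V : finType) (D : complex V) (s : {set V}) :
    {set V} :=
  [set v | (v \in s) || ((v \notin s) && (s :|: [set v] \in simplices D))].

Lemma incident_vertices_nonempty (V : finType) (D : complex V) (s : {set V}) :
  exists v, v \in incident_vertices D s.
Proof.
have [->|[v vs]] := set_0Vmem s; last by exists v; rewrite inE vs.
have /card_gt0P[v _] := vertices_nonempty D.
by exists v; rewrite !inE set0U singleton_simplex.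
Qed.

Definition hmin (R : realType) (V : finType) (D : complex V) (f : V -> R)
    (s : {set V}) : V :=
  [arg min_(v < xchoose (incident_vertices_nonempty D s)
             in incident_vertices D s) f v]%O.

Lemma hminP (R : realType) (V : finType) (D : complex V) (f : V -> R)
    (s : {set V}) (v : V) : injective f ->
  (v = hmin D f s) <->
  (v \in incident_vertices D s /\
   forall w, w \in incident_vertices D s -> f v <= f w).
Proof.
move=> finj; rewrite /hmin.
case: arg_minP => [|u uH umin]; first exact: xchooseP.
split=> [->|[vH vmin]]; first by split.
by apply/finj/eqP; rewrite eq_le vmin ?umin.
Qed.

Lemma greedy_run_done (R : realType) (V : finType) (D : complex V)
    (f : V -> R) : hasse_arcs (greedy_run D f).1 = set0.
Proof.
rewrite /greedy_run; set st := (_, _).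
suff H n N M : hasse_arcs N = set0 \/ (#|N| <= n)%N ->
    hasse_arcs (iter n (greedy_step f) (N, M)).1 = set0 by apply: H; right.
elim: n N M => [|n IH] N M.
  case=> //; rewrite leqn0 cards_eq0 => /eqP ->.
  by apply/setP => a; rewrite !inE.
have [A0 _|[a aA] [A0|leN]] := set_0Vmem (hasse_arcs N); rewrite iterSr.
- apply: IH; left; rewrite /= -[RHS]A0; congr hasse_arcs.
  apply/setDidPl; rewrite disjoint_sym disjoints_subset.
  apply/subsetP => s; rewrite inE => /exists_inP[c].
  by rewrite inE A0 inE.
- by rewrite A0 inE in aA.
apply: IH; right; rewrite /= -ltnS; apply: leq_trans leN.
pose m := [arg min_(b < a in hasse_arcs N) weight f b]%O.
have mmin : m \in min_arcs f N.
  rewrite inE /m; case: arg_minP => //= u uA umin.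
  by rewrite uA; apply/forall_inP.
apply/proper_card/properP; split; first exact: subsetDl.
exists m.1; first by move: mmin; rewrite !inE => /andP[/and3P[]].
rewrite inE negb_and negbK; apply/orP; left.
by rewrite inE; apply/existsP; exists m; rewrite mmin eqxx.
Qed.

Definition discrete_smooth (R : realType) (V : finType) (D : complex V)
    (f : V -> R) (s : {set V}) : Prop :=
  hmin D f s \in s ->
  forall t : {set V}, t \in simplices D -> facet s t ->
    hmin D f (t :\ hmin D f s) = hmin D f s.

(* Main.v *)
(** The lightest arc at a node may lose to a lighter arc at its other end.  But
    if [v = hmin s] is not in [s], every vertex of [incident_vertices (v |: s)]
    is in [incident_vertices s], so the arc from [s] to [v |: s] is lightest at
    both of its ends, and the greedy matching contains it and no other arc
    meeting it.
    This settles the case [hmin s \notin s].  If [v = hmin s] is in [s] and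
    [s] were matched to [t] above it, smoothness would give [hmin (t :\ v) = v],
    so [t] would also be matched to [t :\ v], which differs from [s]. *)
Require Import Defs.
From mathcomp Require Import all_boot all_order all_algebra.
From mathcomp Require Import reals.

Set Implicit Arguments.
Unset Strict Implicit.
Unset Printing Implicit Defensive.

Import Order.TTheory GRing.Theory Num.Theory.
Local Open Scope ring_scope.

Lemma setU1_setD (V : finType) (v : V) (s : {set V}) :
  v \notin s -> (v |: s) :\: s = [set v].
Proof.
move=> vNs; apply/setP => x; rewrite !inE.
by case: eqP => [->|_]; rewrite ?vNs // andNb.
Qed.

Lemma facetP (V : finType) (s t : {set V}) :
  reflect (exists2 v, v \notin s & t = v |: s) (facet s t).
Proof.
rewrite /facet /dim.
(* Passing from integer dimensions to cardinalities treats the empty simplex, of dimension -1, like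
   all others. *)
have -> : (#|s|%:Z - 1 == #|t|%:Z - 1 - 1) = (#|t| == #|s|.+1)%N.
  by rewrite (inj_eq (addIr _)) eq_sym subr_eq -PoszD addn1.
apply: (iffP andP) => [[sub_st /eqP card_t]|[v vNs ->]]; last first.
  by rewrite subsetUr cardsU1 vNs.
have /cards1P[v def_v] : #|t :\: s| == 1%N.
  by rewrite cardsD (setIidPr sub_st) card_t subSnn.
exists v; first by have := set11 v; rewrite -def_v inE => /andP[].
by rewrite -def_v setUC setDE setUIr setUCr setIT; apply/esym/setUidPr.
Qed.

Lemma weight_setU1 (R : realType) (V : finType) (f : V -> R) (v : V)
    (s : {set V}) : v \notin s -> weight f (s, v |: s) = f v.
Proof.
move=> vNs; rewrite /weight /= setU1_setD //.
by case: pickP => [w|/(_ v)]; rewrite !inE ?eqxx // => /eqP->.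
Qed.

Definition ends (V : finType) (a : {set V} * {set V}) : {set {set V}} :=
  [set a.1; a.2].

Definition meets (V : finType) (a b : {set V} * {set V}) : bool :=
  ends a :&: ends b != set0.

Lemma meetsP (V : finType) (a b : {set V} * {set V}) :
  reflect (exists x, x \in ends a /\ x \in ends b) (meets a b).
Proof.
apply: (iffP (set0Pn _)) => [[x /setIP[xa xb]]|[x [xa xb]]]; exists x => //.
by rewrite inE xa.
Qed.

Lemma end_nodesP (V : finType) (A : {set {set V} * {set V}}) (x : {set V}) :
  reflect (exists2 a, a \in A & x \in ends a) (x \in end_nodes A).
Proof.
rewrite inE; apply: (iffP exists_inP) => -[a aA xa]; exists a => //;
  by rewrite !inE in xa *.
Qed.

Lemma hasse_arcs_sub (V : finType) (N : {set {set V}})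
    (a : {set V} * {set V}) : a \in hasse_arcs N -> {subset ends a <= N}.
Proof.
by rewrite inE => /and3P[a1N a2N _] x; rewrite !inE => /orP[]/eqP->.
Qed.

Lemma hasse_arcs_mono (V : finType) (N N' : {set {set V}}) :
  N \subset N' -> hasse_arcs N \subset hasse_arcs N'.
Proof.
move=> /subsetP sub; apply/subsetP => a; rewrite !inE.
by case/and3P => /sub-> /sub->.
Qed.

(** By injectivity both arcs add the same vertex [v]. A common node cannot be the lower end of one
    and the upper end of the other, since it would both omit and contain [v]; and either end
    together with [v] determines the arc. *)
Lemma meeting_arcs_eq (R : realType) (V : finType) (f : V -> R)
    (a b : {set V} * {set V}) : injective f ->
  facet a.1 a.2 -> facet b.1 b.2 -> meets a b -> weight f a = weight f b ->
  a = b.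
Proof.
case: a b => [s t] [s' t'] f_inj /= /facetP[v vNs ->] /facetP[w wNs' ->] ab.
rewrite !weight_setU1 // => /f_inj vw; rewrite -{}vw {w} in wNs' ab *.
case/meetsP: ab => x []; rewrite !inE /= => /orP[]/eqP-> /orP[]/eqP eq_x.
- by rewrite eq_x.
- by rewrite eq_x setU11 in vNs.
- by rewrite -eq_x setU11 in wNs'.
- by have := congr1 (fun A => A :\ v) eq_x; rewrite /= !setU1K // => ->.
Qed.

(** Unlike membership in [min_arcs], this compares [a] only with arcs sharing a node with it, so it
    can be checked in the full diagram without following the run. *)
Definition locally_min (R : realType) (V : finType) (f : V -> R)
    (N : {set {set V}}) (a : {set V} * {set V}) : Prop :=
  a \in hasse_arcs N /\
  forall b, b \in hasse_arcs N -> meets a b -> weight f a <= weight f b.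

Lemma locally_min_sub (R : realType) (V : finType) (f : V -> R)
    (N N' : {set {set V}}) (a : {set V} * {set V}) :
  N' \subset N -> a \in hasse_arcs N' -> locally_min f N a ->
  locally_min f N' a.
Proof.
move=> sub aN' [_ amin]; split=> // b bN'.
by apply: amin; apply: (subsetP (hasse_arcs_mono sub)).
Qed.

(** Each of the two weights bounds the other, so they agree, and meeting arcs of equal weight
    coincide. *)
Lemma locally_min_min_arcs (R : realType) (V : finType) (f : V -> R)
    (N : {set {set V}}) (a b : {set V} * {set V}) : injective f ->
  locally_min f N a -> b \in min_arcs f N -> meets a b -> b = a.
Proof.
move=> f_inj [aN amin]; rewrite inE => /andP[bN /forall_inP bmin] ab.
apply/esym/(meeting_arcs_eq f_inj _ _ ab).
- by move: aN; rewrite inE => /and3P[].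
- by move: bN; rewrite inE => /and3P[].
- by apply/eqP; rewrite eq_le amin ?bmin.
Qed.

(** Invariant of the run: either [a] is still present and untouched by the matching, or it has been
    chosen and its ends are deleted, so that no arc added later can meet it. *)
Lemma locally_min_iter (R : realType) (V : finType) (f : V -> R)
    (N0 : {set {set V}}) (a : {set V} * {set V}) (n : nat) : injective f ->
  locally_min f N0 a ->
  let st := iter n (greedy_step f) (N0, set0) in
  (locally_min f st.1 a /\ forall b, b \in st.2 -> ~~ meets a b) \/
  [/\ a \in st.2, [disjoint ends a & st.1] &
      forall b, b \in st.2 -> meets a b -> b = a].
Proof.
move=> f_inj a_min0; elim: n => [|n] /=.
  by left; split=> // b; rewrite inE.
case: (iter n _ _) => N M /= [[a_min aM]|[aM aN M_a]]; last first.
  right; split; first by rewrite inE aM.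
    by apply: disjointWr aN; apply: subsetDl.
  move=> b /setUP[/M_a //|]; rewrite inE => /andP[bN _] /meetsP[x [xa xb]].
  have := disjointFr aN xa.
  by rewrite (hasse_arcs_sub bN xb).
have [a_in|a_out] := boolP (a \in min_arcs f N).
  right; split; first by rewrite inE a_in orbT.
    rewrite disjoint_subset; apply/subsetP => x xa.
    rewrite inE /= in_setD negb_and negbK.
    by apply/orP; left; apply/end_nodesP; exists a.
  move=> b /setUP[/aM/negP //|bmin ab].
  exact: (locally_min_min_arcs f_inj a_min bmin).
have disj b : b \in min_arcs f N -> ~~ meets a b.
  move=> bmin; apply/negP => ab.
  by rewrite -(locally_min_min_arcs f_inj a_min bmin ab) bmin in a_out.
left; split; last by move=> b /setUP[/aM|/disj].
apply: (locally_min_sub (subsetDl _ _) _ a_min).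
have [aN _] := a_min.
(* An end of [a] is deleted only by a chosen arc through it, which would meet [a], contrary to
   [disj]. *)
have keep x : x \in ends a -> x \in N :\: end_nodes (min_arcs f N).
  move=> xa; rewrite in_setD (hasse_arcs_sub aN xa) andbT.
  apply/end_nodesP => -[b /disj/negP nab xb]; apply: nab.
  by apply/meetsP; exists x.
move: aN; rewrite inE => /and3P[_ _ fa].
by rewrite inE fa !keep // !inE eqxx ?orbT.
Qed.

(** The run ends with no arc left, which rules out the alternative that [a] is still present. *)
Lemma locally_min_greedy (R : realType) (V : finType) (D : complex V)
    (f : V -> R) (a : {set V} * {set V}) : injective f ->
  locally_min f (simplices D) a ->
  a \in greedy_matching D f /\
  forall b, b \in greedy_matching D f -> meets a b -> b = a.
Proof.
move=> f_inj a_min.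
have [[[a_in _] _]|[aM _ uniq_a]] :=
  locally_min_iter #|simplices D| f_inj a_min; last by split.
by have := greedy_run_done D f; rewrite /greedy_run => E; rewrite E inE in a_in.
Qed.

(** If [w] can be added to [v |: s], it can be added to the face [s]; and [v] itself can be added to
    [s]. *)
Lemma incident_vertices_setU1 (V : finType) (D : complex V) (v : V)
    (s : {set V}) : v |: s \in simplices D ->
  incident_vertices D (v |: s) \subset incident_vertices D s.
Proof.
move=> tD; apply/subsetP => w; rewrite !inE.
case: eqVneq => [->|_] /=; first by rewrite setUC tD andbT orbN.
case: (w \in s) => //= twD; apply: subset_simplex twD _.
by rewrite setSU // subsetUr.
Qed.

(** This lets the minimality of [hmin] over vertices bound the weights of arcs. *)
Lemma weight_incident (R : realType) (V : finType) (D : complex V)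
    (f : V -> R) (b : {set V} * {set V}) (x : {set V}) :
  b \in hasse_arcs (simplices D) -> x \in ends b ->
  exists2 w, w \in incident_vertices D x & weight f b = f w.
Proof.
case: b => s t; rewrite inE => /and3P[/= _ tD /facetP[w wNs def_t]].
rewrite {}def_t in tD * => xb; exists w; last exact: weight_setU1.
by move: xb; rewrite !inE => /orP[]/eqP-> /=;
  rewrite ?(negbTE wNs) ?setU11 // setUC tD.
Qed.

Lemma hmin_arc_locally_min (R : realType) (V : finType) (D : complex V)
    (f : V -> R) (s : {set V}) : injective f ->
  s \in simplices D -> hmin D f s \notin s ->
  locally_min f (simplices D) (s, hmin D f s |: s).
Proof.
move=> f_inj sD vNs.
have [/(_ erefl)[vH vmin] _] := hminP D s (hmin D f s) f_inj.
set v := hmin D f s in vNs vH vmin *.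
have tD : v |: s \in simplices D.
  by move: vH; rewrite inE (negbTE vNs) /= setUC.
split; first by rewrite inE sD tD; apply/facetP; exists v.
move=> b bD /meetsP[x [xa xb]]; rewrite weight_setU1 //.
have [w wx ->] := weight_incident f bD xb; apply: vmin.
move: xa wx; rewrite !in_set2 => /orP[]/eqP-> //.
exact: (subsetP (incident_vertices_setU1 tD)).
Qed.

Theorem theorem18 (R : realType) (V : finType) (D : complex V) (f : V -> R)
    (f_inj : injective f) (s : {set V}) (s_simplex : s \in simplices D)
    (s_smooth : discrete_smooth D f s) :
  forall t : {set V}, t \in simplices D ->
    (facet s t /\ t :\: s = [set hmin D f s]) <-> matched D f s t.
Proof.
move=> t tD; split=> [[/facetP[v vNs def_t]]|/andP[st stM]].
  rewrite def_t setU1_setD // => /set1_inj def_v; apply/andP; split.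
    by apply/facetP; exists v.
  (* The added vertex is [hmin D f s], which therefore lies outside [s]. *)
  rewrite {1}def_v in vNs; rewrite def_v.
  by have [] := locally_min_greedy f_inj (hmin_arc_locally_min f_inj s_simplex vNs).
split=> //; have [vs|vNs] := boolP (hmin D f s \in s); last first.
  have [_ uniq_s] :=
    locally_min_greedy f_inj (hmin_arc_locally_min f_inj s_simplex vNs).
  (* Both arcs are matched and share [s], hence they are equal. *)
  have /(uniq_s _ stM)[->] : meets (s, hmin D f s |: s) (s, t).
    by apply/meetsP; exists s; rewrite !inE eqxx.
  exact: setU1_setD.
have hv := s_smooth vs _ tD st; set v := hmin D f s in vs hv.
have vt : v \in t by case/facetP: st => w _ ->; rewrite !inE vs orbT.
have tvD : t :\ v \in simplices D by apply: subset_simplex tD _; apply: subsetDl.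
have vNtv : hmin D f (t :\ v) \notin t :\ v by rewrite hv !inE eqxx.
have [_ uniq_t] := locally_min_greedy f_inj (hmin_arc_locally_min f_inj tvD vNtv).
(* By smoothness the locally minimal arc found at [t :\ v] leads up to [t], where it meets the arc
   from [s]. *)
rewrite hv setD1K // in uniq_t.
have /(uniq_t _ stM)[def_s] : meets (t :\ v, t) (s, t).
  by apply/meetsP; exists t; rewrite !inE eqxx !orbT.
by rewrite def_s !inE eqxx in vs.
Qed.
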